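(* For every bounded monic reduced motion polynomial $M \in \mathbb{DH}[t]$, the recursive procedure MGFactor described in the context outputs a list $[M_1,M_2,\ldots,M_r]$ of monic motion polynomials such that $M=M_1M_2\cdots M_r$ and $\nu(M_1)=N_1^{n_1},\ \ldots,\ \nu(M_r)=N_r^{n_r}$ for some pairwise coprime real irreducible quadratic polynomials $N_1,N_2,\ldots,N_r$ and positive integers $n_1,n_2,\ldots,n_r$.
   Context: **Notation.** $\mathbb{H}$ denotes the real quaternions with conjugation $q\mapsto q^{*}$. The dual quaternions are $\mathbb{DH}=\mathbb{H}[\varepsilon]/(\varepsilon^2)$, where $\varepsilon$ commutes with everything, and $(p+\varepsilon d)^{*}=p^{*}+\varepsilon d^{*}$. In $\mathbb{DH}[t]$ the indeterminate $t$ commutes with all coefficients; $M^{*}$ is obtained by conjugating all coefficients and $\nu(M):=MM^{*}$. Every $M\in\mathbb{DH}[t]$ is uniquely $M=P+\varepsilon D$ with $P,D\in\mathbb{H}[t]$; $P$ is the primal part. $M$ is a motion polynomial if $MM^{*}\in\mathbb{R}[t]\setminus\{0\}$; it is translational if $P\in\mathbb{R}[t]$. Monic means leading coefficient $1$. $\operatorname{mrpf}(A,B)$ is the greatest common monic real polynomial divisor of $A$ and $B$; $\operatorname{mrpf}(M):=\operatorname{mrpf}(M,M)$ and $\operatorname{mrpf}(0):=1$. $M$ is reduced if $\operatorname{mrpf}(M)=1$. A monic reduced motion polynomial $M=P+\varepsilon D$ is bounded if $\operatorname{mrpf}(P)$ has no real zero. For nonzero $A,B\in\mathbb{H}[t]$,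 $\operatorname{rgcd}(A,B)$ is the unique monic common right divisor of maximal degree. If $A=Q_lB+R_l$ with $\deg R_l<\deg B$, then $\operatorname{lquo}(A,B):=Q_l$. **Auxiliary procedure TransFactor** (splitting a monic translational motion polynomial $f_1f_2+\varepsilon E$ with $E\in\mathbb{H}[t]$ and coprime monic $f_1,f_2\in\mathbb{R}[t]$). Find $d_1,d_2\in\mathbb{R}[t]$ with $f_1d_1+f_2d_2=1$ by the extended Euclidean algorithm. Let $D_1$ be the remainder of $d_2E$ on division by $f_1$, and $D_2$ the remainder of $d_1E$ on division by $f_2$. Return $f_1+\varepsilon D_1$ and $f_2+\varepsilon D_2$. **Procedure MGFactor** (input: a bounded monic reduced motion polynomial $M=P+\varepsilon D$). 1. If $\deg M=0$, return the empty list. 2. Let $N$ be a (monic irreducible) quadratic real factor of $\nu(M)\in\mathbb{R}[t]$, and $n$ its multiplicity in $\nu(M)$. 3. Put $Q:=P/\operatorname{mrpf}(P)$, $c_2:=\operatorname{mrpf}(P,N^n)$, $c_1:=\operatorname{mrpf}(P)/c_2$. 4. Put $Q_2:=\operatorname{rgcd}(N^n/c_2^2,\,Q)$ and $Q_1:=\operatorname{lquo}(Q,Q_2)$. 5. Put $M_t:=c_1c_2\,\nu(Q_1)\nu(Q_2)+\varepsilon\,Q_1^{*}DQ_2^{*}$. 6. Using TransFactor with $f_1=c_1\nu(Q_1)$, $f_2=c_2\nu(Q_2)$, compute the factorization $M_t=(c_1\nu(Q_1)+\varepsilon D_1)(c_2\nu(Q_2)+\varepsilon D_2)$. 7. Put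 $M':=c_1Q_1+\varepsilon\,\dfrac{Q_1D_1}{\nu(Q_1)}$ and $M_{\mathrm{last}}:=c_2Q_2+\varepsilon\,\dfrac{D_2Q_2}{\nu(Q_2)}$. 8. Return the list obtained by appending $M_{\mathrm{last}}$ at the end of the list MGFactor$(M')$. *)

(* Defs.v *)
From HB Require Import structures.
From mathcomp Require Import all_boot all_order all_algebra.
From mathcomp Require Import ring.
From mathcomp Require Import boolp classical_sets reals.

Set Implicit Arguments.
Unset Strict Implicit.
Unset Printing Implicit Defensive.

Import Order.TTheory GRing.Theory Num.Theory.
Local Open Scope ring_scope.

(* [Quat a b c d] is a + b i + c j + d k. *)
Record quat (R : Type) := Quat { qre : R; qi : R; qj : R; qk : R }.

Definition tuple_of_quat (R : Type) (q : quat R) :=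
  (qre q, qi q, qj q, qk q).
Definition quat_of_tuple (R : Type) (t : R * R * R * R) :=
  let: (a, b, c, d) := t in Quat a b c d.
Lemma tuple_of_quatK (R : Type) :
  cancel (@tuple_of_quat R) (@quat_of_tuple R).
Proof. by case. Qed.

HB.instance Definition _ (R : eqType) :=
  Equality.copy (quat R) (can_type (@tuple_of_quatK R)).
HB.instance Definition _ (R : choiceType) :=
  Choice.copy (quat R) (can_type (@tuple_of_quatK R)).

Section QuaternionAlgebra.
Variable R : comNzRingType.
Implicit Types p q r : quat R.

Definition addq p q :=
  Quat (qre p + qre q) (qi p + qi q) (qj p + qj q) (qk p + qk q).
Definition oppq p := Quat (- qre p) (- qi p) (- qj p) (- qk p).
Definition mulq p q :=
  Quat (qre p * qre q - qi p * qi q - qj p * qj q - qk p * qk q)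
       (qre p * qi q + qi p * qre q + qj p * qk q - qk p * qj q)
       (qre p * qj q - qi p * qk q + qj p * qre q + qk p * qi q)
       (qre p * qk q + qi p * qj q - qj p * qi q + qk p * qre q).
Definition scaleq (a : R) p := Quat (a * qre p) (a * qi p) (a * qj p) (a * qk p).
Definition conjq p := Quat (qre p) (- qi p) (- qj p) (- qk p).

Fact addqA : associative addq.
Proof. by move=> [a b c d] [? ? ? ?] [? ? ? ?]; congr Quat => /=; ring. Qed.
Fact addqC : commutative addq.
Proof. by move=> [? ? ? ?] [? ? ? ?]; congr Quat => /=; ring. Qed.
Fact add0q : left_id (Quat 0 0 0 0) addq.
Proof. by move=> [? ? ? ?]; congr Quat => /=; ring. Qed.
Fact addNq : left_inverse (Quat 0 0 0 0) oppq addq.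
Proof. by move=> [? ? ? ?]; congr Quat => /=; ring. Qed.
HB.instance Definition _ := GRing.isZmodule.Build (quat R) addqA addqC add0q addNq.

Fact mulqA : associative mulq.
Proof. by move=> [? ? ? ?] [? ? ? ?] [? ? ? ?]; congr Quat => /=; ring. Qed.
Fact mul1q : left_id (Quat 1 0 0 0) mulq.
Proof. by move=> [? ? ? ?]; congr Quat => /=; ring. Qed.
Fact mulq1 : right_id (Quat 1 0 0 0) mulq.
Proof. by move=> [? ? ? ?]; congr Quat => /=; ring. Qed.
Fact mulqDl : left_distributive mulq +%R.
Proof. by move=> [? ? ? ?] [? ? ? ?] [? ? ? ?]; congr Quat => /=; ring. Qed.
Fact mulqDr : right_distributive mulq +%R.
Proof. by move=> [? ? ? ?] [? ? ? ?] [? ? ? ?]; congr Quat => /=; ring. Qed.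
Fact oneq_neq0 : Quat 1 0 0 0 != 0 :> quat R.
Proof. by apply/eqP => -[/eqP]; rewrite oner_eq0. Qed.
HB.instance Definition _ := GRing.Zmodule_isNzRing.Build (quat R)
  mulqA mul1q mulq1 mulqDl mulqDr oneq_neq0.

Fact scaleqA a b p : scaleq a (scaleq b p) = scaleq (a * b) p.
Proof. by case: p => *; congr Quat => /=; ring. Qed.
Fact scale1q : left_id 1 scaleq.
Proof. by move=> [? ? ? ?]; congr Quat => /=; ring. Qed.
Fact scaleqDr : right_distributive scaleq +%R.
Proof. by move=> a [? ? ? ?] [? ? ? ?]; congr Quat => /=; ring. Qed.
Fact scaleqDl p : {morph scaleq^~ p : a b / a + b}.
Proof. by move=> a b; case: p => *; congr Quat => /=; ring. Qed.
HB.instance Definition _ := GRing.Zmodule_isLmodule.Build R (quat R)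
  scaleqA scale1q scaleqDr scaleqDl.

Fact scaleqAl (a : R) p q : a *: (p * q) = (a *: p) * q.
Proof. by case: p q => [? ? ? ?] [? ? ? ?]; congr Quat => /=; ring. Qed.
HB.instance Definition _ := GRing.Lmodule_isLalgebra.Build R (quat R) scaleqAl.
Fact scaleqAr (a : R) p q : a *: (p * q) = p * (a *: q).
Proof. by case: p q => [? ? ? ?] [? ? ? ?]; congr Quat => /=; ring. Qed.
HB.instance Definition _ := GRing.Lalgebra_isAlgebra.Build R (quat R) scaleqAr.

End QuaternionAlgebra.

(* [DQuat p d] is p + epsilon d with epsilon central and epsilon ^ 2 = 0. *)
Record dquat (R : Type) := DQuat { primal : quat R; dual : quat R }.

Definition pair_of_dquat (R : Type) (x : dquat R) := (primal x, dual x).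
Definition dquat_of_pair (R : Type) (u : quat R * quat R) := DQuat u.1 u.2.
Lemma pair_of_dquatK (R : Type) : cancel (@pair_of_dquat R) (@dquat_of_pair R).
Proof. by case. Qed.

HB.instance Definition _ (R : eqType) :=
  Equality.copy (dquat R) (can_type (@pair_of_dquatK R)).
HB.instance Definition _ (R : choiceType) :=
  Choice.copy (dquat R) (can_type (@pair_of_dquatK R)).

Section DualQuaternionAlgebra.
Variable R : comNzRingType.
Implicit Types x y z : dquat R.

Definition adddq x y := DQuat (primal x + primal y) (dual x + dual y).
Definition oppdq x := DQuat (- primal x) (- dual x).
Definition muldq x y :=
  DQuat (primal x * primal y) (primal x * dual y + dual x * primal y).
Definition scaledq (a : R) x := DQuat (a *: primal x) (a *: dual x).
Definition conjdq x := DQuat (conjq (primal x)) (conjq (dual x)).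

Fact adddqA : associative adddq.
Proof. by move=> [? ?] [? ?] [? ?]; congr DQuat => /=; rewrite addrA. Qed.
Fact adddqC : commutative adddq.
Proof. by move=> [? ?] [? ?]; congr DQuat => /=; rewrite addrC. Qed.
Fact add0dq : left_id (DQuat 0 0) adddq.
Proof. by move=> [? ?]; congr DQuat => /=; rewrite add0r. Qed.
Fact addNdq : left_inverse (DQuat 0 0) oppdq adddq.
Proof. by move=> [? ?]; congr DQuat => /=; rewrite addNr. Qed.
HB.instance Definition _ :=
  GRing.isZmodule.Build (dquat R) adddqA adddqC add0dq addNdq.

Fact muldqA : associative muldq.
Proof.
by move=> [? ?] [? ?] [? ?]; congr DQuat => /=;
  rewrite ?mulrDl ?mulrDr !mulrA ?addrA.
Qed.
Fact mul1dq : left_id (DQuat 1 0) muldq.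
Proof. by move=> [? ?]; congr DQuat => /=; rewrite !mul1r ?mul0r ?addr0. Qed.
Fact muldq1 : right_id (DQuat 1 0) muldq.
Proof. by move=> [? ?]; congr DQuat => /=; rewrite !mulr1 ?mulr0 ?add0r. Qed.
Fact muldqDl : left_distributive muldq +%R.
Proof.
by move=> [? ?] [? ?] [? ?]; congr DQuat => /=; rewrite !mulrDl // addrACA.
Qed.
Fact muldqDr : right_distributive muldq +%R.
Proof.
by move=> [? ?] [? ?] [? ?]; congr DQuat => /=; rewrite !mulrDr // addrACA.
Qed.
Fact onedq_neq0 : DQuat 1 0 != 0 :> dquat R.
Proof. by apply/eqP => -[/eqP]; rewrite oner_eq0. Qed.
HB.instance Definition _ := GRing.Zmodule_isNzRing.Build (dquat R)
  muldqA mul1dq muldq1 muldqDl muldqDr onedq_neq0.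

Fact scaledqA a b x : scaledq a (scaledq b x) = scaledq (a * b) x.
Proof. by congr DQuat => /=; rewrite scalerA. Qed.
Fact scale1dq : left_id 1 scaledq.
Proof. by move=> [? ?]; congr DQuat => /=; rewrite scale1r. Qed.
Fact scaledqDr : right_distributive scaledq +%R.
Proof. by move=> a x y; congr DQuat => /=; rewrite scalerDr. Qed.
Fact scaledqDl x : {morph scaledq^~ x : a b / a + b}.
Proof. by move=> a b; congr DQuat => /=; rewrite scalerDl. Qed.
HB.instance Definition _ := GRing.Zmodule_isLmodule.Build R (dquat R)
  scaledqA scale1dq scaledqDr scaledqDl.

Fact scaledqAl (a : R) x y : a *: (x * y) = (a *: x) * y.
Proof. by congr DQuat => /=; rewrite ?scalerDr !scalerAl. Qed.
HB.instance Definition _ := GRing.Lmodule_isLalgebra.Build R (dquat R) scaledqAl.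
Fact scaledqAr (a : R) x y : a *: (x * y) = x * (a *: y).
Proof. by congr DQuat => /=; rewrite ?scalerDr !scalerAr. Qed.
HB.instance Definition _ := GRing.Lalgebra_isAlgebra.Build R (dquat R) scaledqAr.

End DualQuaternionAlgebra.

Section RealDivisors.
Variables (R : realType) (A : algType R).

Definition rpoly (f : {poly R}) : {poly A} := map_poly (in_alg A) f.

Definition rpoly_dvd (f : {poly R}) (F : {poly A}) : Prop :=
  exists G, F = rpoly f * G.

Definition is_mrpf (F G : {poly A}) (g : {poly R}) : Prop :=
  [/\ g \is monic, rpoly_dvd g F, rpoly_dvd g G
    & forall h : {poly R},
        h \is monic -> rpoly_dvd h F -> rpoly_dvd h G -> h %| g].

(* No [g] satisfies [is_mrpf 0 0 g], so that [mrpf 0 0 = 1]. *)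
Definition mrpf (F G : {poly A}) : {poly R} := xget 1 (is_mrpf F G).

End RealDivisors.
Arguments rpoly {R A} f.

Section Quaternions.
Variable R : realType.
Implicit Types (A B F G Q E : {poly quat R}) (M : {poly dquat R}).

(* For every Q the product Q Q^* has real coefficients; [qnorm Q] is this
   product viewed in R[t]. *)
Definition qnorm Q : {poly R} := map_poly (@qre R) (Q * map_poly (@conjq R) Q).

Definition right_dvd G F : Prop := exists F', F = F' * G.

Definition is_rgcd A B G : Prop :=
  [/\ G \is monic, right_dvd G A, right_dvd G B
    & forall G', G' \is monic -> right_dvd G' A -> right_dvd G' B ->
        (size G' <= size G)%N].

Definition rgcd A B : {poly quat R} := xget 0 (is_rgcd A B).

Definition lquo A B : {poly quat R} :=
  xget 0 (fun Ql => exists2 Rl, A = Ql * B + Rl & (size Rl < size B)%N).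

(* [dpoly F G] is F + epsilon G. *)
Definition dpoly F G : {poly dquat R} :=
  map_poly (fun p => DQuat p 0) F + map_poly (DQuat 0) G.

Definition primal_part M : {poly quat R} := map_poly (@primal R) M.
Definition dual_part M : {poly quat R} := map_poly (@dual R) M.

Definition nu M : {poly dquat R} := M * map_poly (@conjdq R) M.

Definition motion M : Prop := exists2 f : {poly R}, f != 0 & nu M = rpoly f.

(* [nu M] viewed in R[t], when M is a motion polynomial. *)
Definition rnu M : {poly R} := map_poly (fun x => qre (primal x)) (nu M).

Definition reduced M : Prop := mrpf M M = 1.

Definition bounded M : Prop :=
  [/\ M \is monic, motion M, reduced M
    & forall x : R, ~~ root (mrpf (primal_part M) (primal_part M)) x].

(* For coprime f1 and f2 the combination [c] of the cofactors returned by the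
   extended Euclidean algorithm is a nonzero constant, so that
   f1 d1 + f2 d2 = 1. *)
Definition TransFactor (f1 f2 : {poly R}) E :
    {poly dquat R} * {poly dquat R} :=
  let e := egcdp f1 f2 in
  let c := e.1 * f1 + e.2 * f2 in
  let d1 := (c`_0)^-1 *: e.1 in
  let d2 := (c`_0)^-1 *: e.2 in
  (dpoly (rpoly f1) (Pdiv.Ring.rmodp (rpoly d2 * E) (rpoly f1)),
   dpoly (rpoly f2) (Pdiv.Ring.rmodp (rpoly d1 * E) (rpoly f2))).

Definition quadratic_factor (N f : {poly R}) : Prop :=
  [/\ N \is monic, size N = 3%N, irreducible_poly N & N %| f].

(* [MGFactor_step M N M' Mlast] splits M = M' Mlast with nu Mlast = N ^ n, for
   n the multiplicity of N in nu M.  In terms of M_t = f1 f2 + epsilon E one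
   has Q1 M_t Q2 = qnorm Q1 * qnorm Q2 * M, so that a factorization of M_t into
   f1 + epsilon D1 and f2 + epsilon D2 yields one of M.
   All divisions are exact and are expressed by multiplication:
   w = N ^ n / c2 ^ 2, S1 = Q1 D1 / nu(Q1) and S2 = D2 Q2 / nu(Q2).  The inputs
   of [TransFactor] are required to be as it expects, and its outputs to
   multiply to M_t.  When one of these requirements fails there is no step. *)
Variant MGFactor_step M (N : {poly R}) :
    {poly dquat R} -> {poly dquat R} -> Prop :=
  MGFactorStep (n : nat) (c1 c2 w f1 f2 : {poly R})
      (P D Q Q1 Q2 E D1 D2 S1 S2 : {poly quat R}) of
      P = primal_part M & D = dual_part M
    & N ^+ n %| rnu M & ~~ (N ^+ n.+1 %| rnu M)
    & P = rpoly (mrpf P P) * Q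
    & c2 = mrpf P (rpoly (N ^+ n))
    & mrpf P P = c1 * c2
    & N ^+ n = w * c2 ^+ 2
    & Q2 = rgcd (rpoly w) Q
    & Q1 = lquo Q Q2
    & f1 = c1 * qnorm Q1 & f2 = c2 * qnorm Q2
    & E = map_poly (@conjq R) Q1 * D * map_poly (@conjq R) Q2
    & f1 \is monic & f2 \is monic & coprimep f1 f2
    & motion (dpoly (rpoly (f1 * f2)) E)
    & TransFactor f1 f2 E = (dpoly (rpoly f1) D1, dpoly (rpoly f2) D2)
    & dpoly (rpoly (f1 * f2)) E = dpoly (rpoly f1) D1 * dpoly (rpoly f2) D2
    & Q1 * D1 = rpoly (qnorm Q1) * S1
    & D2 * Q2 = rpoly (qnorm Q2) * S2 :
  MGFactor_step M N (dpoly (rpoly c1 * Q1) S1) (dpoly (rpoly c2 * Q2) S2).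

(* [MGFactor M L]: some run on M, i.e. some choice of a quadratic factor in
   every recursive call, returns L. *)
Inductive MGFactor : {poly dquat R} -> seq {poly dquat R} -> Prop :=
| MGFactor_nil M of size M = 1%N : MGFactor M [::]
| MGFactor_rcons M N M' Mlast L of
      (1 < size M)%N & quadratic_factor N (rnu M)
    & MGFactor_step M N M' Mlast & MGFactor M' L :
  MGFactor M (rcons L Mlast).

(* Every run on M terminates without getting stuck: whenever the degree is
   positive a quadratic factor can be chosen, for every choice the step can be
   carried out, and the recursive call is made on an admissible input. *)
Inductive MGFactor_total : {poly dquat R} -> Prop :=
| MGFactor_total_nil M of size M = 1%N : MGFactor_total M
| MGFactor_total_rec M of
      (1 < size M)%N
    & (exists N, quadratic_factor N (rnu M))
    & (forall N, quadratic_factor N (rnu M) ->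
         exists M' Mlast, MGFactor_step M N M' Mlast)
    & (forall N M' Mlast, quadratic_factor N (rnu M) ->
         MGFactor_step M N M' Mlast -> bounded M' /\ MGFactor_total M') :
  MGFactor_total M.

End Quaternions.

(* Main.v *)
From HB Require Import structures.
Require Import Defs.
From mathcomp Require Import all_boot all_order all_algebra.
From mathcomp Require Import ring zify.
From mathcomp Require Import boolp classical_sets reals.
From mathcomp Require Import complex.

Set Implicit Arguments.
Unset Strict Implicit.
Unset Printing Implicit Defensive.

Import Order.TTheory GRing.Theory Num.Theory.
Local Open Scope ring_scope.

(** Write [M = P + epsilon D] with [P] monic. Then [M] is a motion polynomial
    exactly when [P D^* + D P^* = 0], and in that case [nu M = P P^*] is the
    norm of [P] ([motion_dpoly], [rnu_dpoly]). Split off the real content, [P =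
    c Q] with [Q] primitive. A primitive [Q] vanishes at no real point, and
    neither does its norm, a sum of four squares; so boundedness makes [nu M =
    c^2 nu(Q)] free of real roots and hence a product of irreducible quadratics
    ([bounded_norm_root], [exists_quadratic_factor]).

    One step removes the [N]-primary part of [nu M]. Let [N^n] be the exact
    power of [N] in [nu M], let [c = c1 c2] with [c2] the [N]-part of [c], and
    let [N^n = w c2^2]. Then [w] is a power of [N] dividing [nu(Q)], and the
    heart of the matter is that [Q2 = rgcd (w, Q)] has norm exactly [w]
    ([qnorm_rgcd]). Bezout, [Q2 = a w + b Q], shows that [w] divides [nu(Q2)].
    Conversely [Q2 F = w] for some [F] and [nu(Q2)] is a power of [N]; if it
    were a higher power than [w], cancelling [Q2] in [Q2 Q2^* = nu(Q2)] would
    exhibit [N] as a divisor of [Q2^*], contradicting primitivity of [Q].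
    Consequently [Q = Q1 Q2] with [c1 nu(Q1)] coprime to [N], and the two real
    polynomials [f1 = c1 nu(Q1)], [f2 = c2 nu(Q2)] are coprime
    ([primary_split]).

    Multiplying [M] by [Q1^*] on the left and by [Q2^*] on the right turns it
    into the translational motion polynomial [f1 f2 + epsilon Q1^* D Q2^*], and
    such polynomials split along coprime real factors by partial fractions
    ([TransFactor_spec]); the degree bound [translation_size] is what makes the
    decomposition exact. Since [Q1 Q1^*] and [Q2^* Q2] are real, this
    factorization transports back to [M] ([recombine]) and all divisions
    involved are exact ([left_exact_quotient], [right_exact_quotient]). The
    right factor has norm [c2^2 w = N^n], the left one has norm coprime to [N]
    and inherits boundedness because it divides [M], so the theorem follows by
    induction on the degree. *)

(** * Division by monic and by real polynomials *)

Section MonicDivision.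
Variable A : nzRingType.
Implicit Types F G X : {poly A}.

Lemma monic_size_gt0 F : F \is monic -> (0 < size F)%N.
Proof. by move=> mF; rewrite size_poly_gt0 monic_neq0. Qed.

Lemma monic_right_small G X :
  G \is monic -> (size (X * G)%R < size G)%N -> X = 0.
Proof.
move=> mG; have [//|nX] := eqVneq X 0.
rewrite size_Mmonic //; move: nX; rewrite -size_poly_gt0.
by case: (size X) => // m _; rewrite addSn /= ltnNge leq_addl.
Qed.

Lemma monic_rmodpE G F : G \is monic ->
  exists2 U, Pdiv.Ring.rmodp F G = F - U * G
    & (size (Pdiv.Ring.rmodp F G) < size G)%N.
Proof.
move=> mG; exists (Pdiv.Ring.rdivp F G).
  by apply/esym/eqP; rewrite subr_eq addrC -Pdiv.RingMonic.rdivp_eq.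
by rewrite Pdiv.Ring.ltn_rmodpN0 ?monic_neq0.
Qed.

End MonicDivision.

Section RealPolynomials.
Variables (R : realType) (A : algType R).
Implicit Types (f g h : {poly R}) (F G X : {poly A}).

HB.instance Definition _ :=
  GRing.RMorphism.copy (@rpoly R A) (map_poly (in_alg A)).

Lemma coef_rpoly f i : (rpoly f : {poly A})`_i = (f`_i)%:A.
Proof. by rewrite /rpoly coef_map. Qed.

Lemma size_rpoly f : size (rpoly f : {poly A}) = size f.
Proof. by rewrite size_map_poly. Qed.

Lemma rpoly_inj : injective (@rpoly R A).
Proof. by apply: map_poly_inj. Qed.

Lemma rpoly_monic f : ((rpoly f : {poly A}) \is monic) = (f \is monic).
Proof. exact: map_monic. Qed.

Lemma rpolyM f g : rpoly (f * g) = rpoly f * rpoly g :> {poly A}.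
Proof. exact: rmorphM. Qed.

Lemma rpoly_comm f F : rpoly f * F = F * rpoly f.
Proof.
apply/polyP => i; rewrite coefM coefMr; apply: eq_bigr => j _.
by rewrite coef_rpoly comm_alg.
Qed.

Lemma rpolyCA f F G : F * (rpoly f * G) = rpoly f * (F * G).
Proof. by rewrite !mulrA rpoly_comm. Qed.

(** Euclidean division by [g] has real quotient and remainder, and remainders
    by a monic polynomial are unique in [{poly A}] as well. *)
Lemma rpoly_dvd_rpoly g f :
  g \is monic -> rpoly_dvd g (rpoly f : {poly A}) -> g %| f.
Proof.
move=> mg [X eX].
have mG : (rpoly g : {poly A}) \is monic by rewrite rpoly_monic.
have e : rpoly (f %% g) = (X - rpoly (f %/ g)) * rpoly g :> {poly A}.
  rewrite mulrBl -rpoly_comm -eX {2}(divp_eq f g) rmorphD rmorphM.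
  by rewrite [RHS]addrAC subrr add0r.
have := ltn_modp f g.
rewrite (monic_neq0 mg) -(size_rpoly (f %% g)) -(size_rpoly g).
rewrite e => /(monic_right_small mG) X0.
by apply/eqP/rpoly_inj; rewrite e X0 mul0r rmorph0.
Qed.

Lemma rpoly_dvdM h g F : rpoly_dvd g F -> rpoly_dvd (h * g) (rpoly h * F).
Proof. by case=> X ->; exists X; rewrite rmorphM mulrA. Qed.

Lemma rpoly_dvd_mull g F G : rpoly_dvd g F -> rpoly_dvd g (G * F).
Proof. by case=> X ->; exists (G * X); rewrite rpolyCA. Qed.

Lemma rpoly_dvdD g F G : rpoly_dvd g F -> rpoly_dvd g G -> rpoly_dvd g (F + G).
Proof. by move=> [X ->] [Y ->]; exists (X + Y); rewrite mulrDr. Qed.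

Lemma rpoly_dvd_mulr g F G : rpoly_dvd g F -> rpoly_dvd g (F * G).
Proof. by case=> X ->; exists (X * G); rewrite mulrA. Qed.

Lemma dvdp_rpoly_dvd h g F : h %| g -> rpoly_dvd g F -> rpoly_dvd h F.
Proof.
move=> /dvdpP[k ->] [X ->]; exists (rpoly k * X).
by rewrite rmorphM -!mulrA rpolyCA.
Qed.

Lemma rpoly_dvd_size g F : F != 0 -> rpoly_dvd g F -> (size g <= size F)%N.
Proof.
move=> nF [X eX]; have [g0|ng] := eqVneq g 0.
  by move: nF; rewrite eX g0 rmorph0 mul0r eqxx.
pose h := (lead_coef g)^-1 *: g.
have ngl : lead_coef g != 0 by rewrite lead_coef_eq0.
have mh : h \is monic by rewrite monicE lead_coefZ mulVf.
have sh : size h = size g by rewrite size_scale // invr_eq0.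
have [Y eY] : rpoly_dvd h F.
  by apply: dvdp_rpoly_dvd (ex_intro _ X eX); rewrite dvdpZl // invr_eq0.
have nY : Y != 0 by apply: contraNneq nF => Y0; rewrite eY Y0 mulr0.
rewrite eY size_monicM ?rpoly_monic // size_rpoly sh.
rewrite -size_poly_gt0 in nY.
by case: (size Y) nY => // m _; rewrite addnS leq_addr.
Qed.

(** Over a field the least common multiple [m] of [g] and [h] comes with a
    Bezout identity, so divisibility by [g] and [h] gives divisibility by [m]
    in any algebra. *)
Lemma rpoly_dvd_lcm g h : g != 0 -> h != 0 ->
  exists m, [/\ m != 0, g %| m, h %| m
    & forall F, rpoly_dvd g F -> rpoly_dvd h F -> rpoly_dvd m F].
Proof.
move=> ng nh; pose d := gcdp g h.
have nd : d != 0 by rewrite gcdp_eq0 negb_and ng.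
have eg : g = g %/ d * d by rewrite divpK ?dvdp_gcdl.
have eh : h = h %/ d * d by rewrite divpK ?dvdp_gcdr.
have /Bezout_eq1_coprimepP[[u v] /= uv1] : coprimep (g %/ d) (h %/ d).
  by rewrite coprimep_div_gcd ?ng.
move: (g %/ d) (h %/ d) eg eh uv1 => g' h' eg eh uv1.
exists (g' * h); split.
- by rewrite mulf_neq0 //; apply: contraNneq ng => g0; rewrite eg g0 mul0r.
- by rewrite eh eg mulrCA dvdp_mull.
- exact: dvdp_mull.
move=> F [X eX] [Y eY]; exists (rpoly u * Y + rpoly v * X).
rewrite -[LHS]mul1r -(rmorph1 (@rpoly R A)) -uv1 rmorphD mulrDl.
rewrite {1}eY eX mulrDr !mulrA -!rmorphM; congr (rpoly _ * _ + rpoly _ * _).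
  by ring.
by rewrite eg eh; ring.
Qed.

(** A common divisor of maximal degree is divisible by every other one: its
    least common multiple with another common divisor is again one. *)
Lemma mrpfP F G : F != 0 -> is_mrpf F G (mrpf F G).
Proof.
move=> nF; apply: xgetPex.
pose S n :=
  `[< exists g, [/\ g != 0, size g = n, rpoly_dvd g F & rpoly_dvd g G] >].
have S0 : exists n, S n.
  exists 1%N; apply/asboolP; exists 1; rewrite oner_neq0 size_poly1.
  by split=> //; [exists F | exists G]; rewrite rmorph1 mul1r.
have Sle n : S n -> (n <= size F)%N.
  by move=> /asboolP[g [_ <- gF _]]; exact: rpoly_dvd_size.
case: (ex_maxnP S0 Sle) => _ /asboolP[g [ng <- gF gG]] gmax.
have ngl : lead_coef g != 0 by rewrite lead_coef_eq0.
have gZ : (lead_coef g)^-1 *: g %= g by rewrite eqp_scale ?invr_eq0.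
exists ((lead_coef g)^-1 *: g); split.
- by rewrite monicE lead_coefZ mulVf.
- by apply: dvdp_rpoly_dvd gF; rewrite (eqp_dvdl _ gZ).
- by apply: dvdp_rpoly_dvd gG; rewrite (eqp_dvdl _ gZ).
move=> h mh hF hG; rewrite (eqp_dvdr _ gZ).
have nh := monic_neq0 mh.
have [m [nm gm hm mlcm]] := rpoly_dvd_lcm ng nh.
have mF := mlcm _ gF hF; have mG := mlcm _ gG hG.
have /gmax sm : S (size m) by apply/asboolP; exists m.
apply: dvdp_trans hm _.
have : g %= m by rewrite -dvdp_size_eqp // eqn_leq sm dvdp_leq.
by case/andP.
Qed.

End RealPolynomials.

(** * Conjugation and norm of quaternionic polynomials *)

Section ConjugateAdditive.
Variable R : comNzRingType.

Fact conjq_zmod_morphism : zmod_morphism (@conjq R).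
Proof. by move=> [? ? ? ?] [? ? ? ?]; congr Quat => /=; ring. Qed.
HB.instance Definition _ :=
  GRing.isZmodMorphism.Build (quat R) (quat R) (@conjq R) conjq_zmod_morphism.

Fact qre_zmod_morphism : zmod_morphism (@qre R).
Proof. by []. Qed.
HB.instance Definition _ :=
  GRing.isZmodMorphism.Build (quat R) R (@qre R) qre_zmod_morphism.

Lemma conjqM (p q : quat R) : conjq (p * q) = conjq q * conjq p.
Proof. by case: p q => [? ? ? ?] [? ? ? ?]; congr Quat => /=; ring. Qed.

Lemma conjqK : involutive (@conjq R).
Proof. by case=> a b c d; rewrite /conjq /= !opprK. Qed.

Lemma qre_mulC (p q : quat R) : qre (p * q) = qre (q * p).
Proof. by case: p q => [? ? ? ?] [? ? ? ?] /=; ring. Qed.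

End ConjugateAdditive.

Notation conjp := (map_poly (@conjq _)).

Section QuaternionPolynomials.
Variable R : realType.
Implicit Types (f g h : {poly R}) (F G X Q : {poly quat R}).

Lemma coef_conjp F i : (conjp F)`_i = conjq F`_i.
Proof. by rewrite coef_map. Qed.

Lemma conjpM F G : conjp (F * G) = conjp G * conjp F.
Proof.
apply/polyP => i; rewrite coef_conjp coefM coefMr raddf_sum /=.
by apply: eq_bigr => j _; rewrite !coef_conjp conjqM.
Qed.

Lemma conjpK : involutive (conjp : {poly quat R} -> {poly quat R}).
Proof. by move=> F; apply/polyP => i; rewrite !coef_conjp conjqK. Qed.

Lemma conjq_alg (a : R) : conjq a%:A = a%:A :> quat R.
Proof. by congr Quat => /=; rewrite mulr0 oppr0. Qed.

Lemma conjp_rpoly f : conjp (rpoly f) = rpoly f :> {poly quat R}.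
Proof. by apply/polyP => i; rewrite coef_conjp !coef_rpoly conjq_alg. Qed.

Lemma size_conjp F : size (conjp F) = size F.
Proof. by rewrite size_map_inj_poly ?raddf0 //; exact: can_inj (@conjqK R). Qed.

Lemma conjp_monic F : (conjp F \is monic) = (F \is monic).
Proof.
rewrite !monicE !lead_coefE size_conjp coef_conjp.
rewrite -[X in _ == X](conjqK 1) (inj_eq (can_inj (@conjqK R))).
by have -> : conjq 1 = 1 :> quat R by congr Quat => /=; rewrite oppr0.
Qed.

Lemma rpoly_qre F : conjp F = F -> F = rpoly (map_poly (@qre R) F).
Proof.
move=> e; apply/polyP => i; rewrite coef_rpoly coef_map /=.
have := congr1 (fun G : {poly quat R} => G`_i) e; rewrite coef_conjp.
case: (F`_i) => a b c d [/eqP eb /eqP ec /eqP ed].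
congr Quat; rewrite /= ?mulr1 ?mulr0 //; apply/eqP.
- by rewrite eqNr in eb.
- by rewrite eqNr in ec.
- by rewrite eqNr in ed.
Qed.

Lemma rpoly_qnorm F : rpoly (qnorm F) = F * conjp F.
Proof. by rewrite /qnorm -rpoly_qre // conjpM conjpK. Qed.

(** The real part of a product of quaternions is symmetric in the factors. *)
Lemma qnorm_conjp F : qnorm (conjp F) = qnorm F.
Proof.
apply/polyP => i; rewrite /qnorm !coef_map /= conjpK coefM coefMr !raddf_sum.
by apply: eq_bigr => j _; exact: qre_mulC.
Qed.

Lemma rpoly_qnorm_conjp F : rpoly (qnorm F) = conjp F * F.
Proof. by rewrite -qnorm_conjp rpoly_qnorm conjpK. Qed.

Lemma qnorm_rpoly f : qnorm (rpoly f : {poly quat R}) = f ^+ 2.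
Proof.
by apply: (@rpoly_inj R (quat R)); rewrite rpoly_qnorm conjp_rpoly -rmorphM.
Qed.

Lemma qnormM F G : qnorm (F * G) = qnorm F * qnorm G.
Proof.
apply: (@rpoly_inj R (quat R)); rewrite rmorphM rpoly_qnorm conjpM mulrA.
rewrite -(mulrA F G) -rpoly_qnorm -rpoly_comm -mulrA -rpoly_qnorm.
exact: rpoly_comm.
Qed.

Lemma qnorm_monic F : F \is monic -> qnorm F \is monic.
Proof.
move=> mF; rewrite -(@rpoly_monic R (quat R)) rpoly_qnorm.
by rewrite monicMl ?conjp_monic.
Qed.

Lemma rpoly_qnorm_monic F :
  F \is monic -> (rpoly (qnorm F) : {poly quat R}) \is monic.
Proof. by move=> mF; rewrite rpoly_monic; exact: qnorm_monic. Qed.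

Lemma size_qnorm F : F \is monic -> size (qnorm F) = (size F + size F).-1.
Proof.
move=> mF; rewrite -(@size_rpoly R (quat R)) rpoly_qnorm size_monicM //.
  by rewrite size_conjp.
by rewrite monic_neq0 ?conjp_monic.
Qed.

Lemma mulq_conj_eq0 (q : quat R) : q * conjq q = 0 -> q = 0.
Proof.
case: q => a b c d [/eqP + _ _ _]; rewrite !mulrN !opprK -!expr2 /=.
rewrite !paddr_eq0 ?addr_ge0 ?sqr_ge0 // !sqrf_eq0.
by case/andP=> /andP[/andP[/eqP-> /eqP->] /eqP->] /eqP->.
Qed.

(** Phrased by quantification rather than as [mrpf Q Q = 1], because the latter
    also holds for [Q = 0]. *)
Definition primitive Q := forall g, g \is monic -> rpoly_dvd g Q -> g = 1.

(** Real points are central, so evaluation at [x] is multiplicative and the norm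
    of [Q] at [x] is the norm of the quaternion [Q.[x]].  If it vanishes, then
    so does [Q.[x]] and the real polynomial ['X - x] divides [Q]. *)
Lemma primitive_norm_root Q x : primitive Q -> ~~ root (qnorm Q) x.
Proof.
move=> pQ; apply/negP => /rootP rx.
have cxx (F : {poly quat R}) : comm_poly F (x%:A).
  by rewrite /comm_poly -comm_alg.
have : (rpoly (qnorm Q) : {poly quat R}).[x%:A] = 0.
  by rewrite /rpoly horner_map rx /= scale0r.
rewrite rpoly_qnorm hornerM_comm; last exact: cxx.
have -> : (conjp Q).[x%:A] = conjq Q.[x%:A].
  rewrite !horner_coef size_conjp raddf_sum; apply: eq_bigr => i _ /=.
  by rewrite coef_conjp conjqM !exprZn !expr1n conjq_alg comm_alg.
move=> /mulq_conj_eq0 Qx0.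
have /factor_theorem[X eX] : root Q (x%:A) by apply/eqP.
suff : 'X - x%:P = 1.
  move=> /(congr1 (fun p : {poly R} => size p)).
  by rewrite size_XsubC size_poly1.
apply: pQ; first exact: monicXsubC.
exists X; rewrite rpoly_comm eX; congr (_ * _).
by rewrite /rpoly rmorphB /= map_polyX map_polyC.
Qed.

End QuaternionPolynomials.

(** * Greatest common right divisors *)

Section RightGcd.
Variable R : realType.
Implicit Types (f g h N w : {poly R}) (F G X Q : {poly quat R}).

Lemma quat_left_inverse (q : quat R) : q != 0 -> exists r, r * q = 1.
Proof.
pose s := qre (q * conjq q).
have [e1 e2] : q * conjq q = s%:A /\ conjq q * q = s%:A.
  by rewrite /s; case: (q) => a b c d; split; congr Quat => /=; ring.
move=> nq; have ns : s != 0.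
  by apply: contraNneq nq => s0; apply/eqP/mulq_conj_eq0; rewrite e1 s0 scale0r.
by exists (s^-1 *: conjq q); rewrite -scalerAl e2 scalerA mulVf // scale1r.
Qed.

Lemma quat_poly_normalize X : X != 0 ->
  exists c : quat R, c%:P * X \is monic /\ size (c%:P * X) = size X.
Proof.
rewrite -lead_coef_eq0 => /quat_left_inverse[c ec]; exists c.
have e : lead_coef c%:P * lead_coef X = 1 by rewrite lead_coefC.
have ne : lead_coef c%:P * lead_coef X != 0 by rewrite e oner_neq0.
rewrite monicE lead_coef_proper_mul // e eqxx; split=> //.
rewrite size_proper_mul // size_polyC.
by case: eqP ec => [->|_ _ //]; rewrite mul0r => /esym/eqP; rewrite oner_eq0.
Qed.

(** A monic element of least degree in the left ideal generated by [F] and [Q]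
    right-divides the whole ideal, as remainders stay in the ideal and can be
    made monic because the quaternions form a division ring. *)
Lemma left_ideal_generator F Q : Q \is monic -> exists a b,
  [/\ a * F + b * Q \is monic, right_dvd (a * F + b * Q) F
    & right_dvd (a * F + b * Q) Q].
Proof.
move=> mQ.
have proj1 (T : nzRingType) (u v : T) : 1 * u + 0 * v = u.
  by rewrite mul1r mul0r addr0.
have proj2 (T : nzRingType) (u v : T) : 0 * u + 1 * v = v.
  by rewrite mul0r mul1r add0r.
pose S n :=
  `[< exists a b, a * F + b * Q \is monic /\ size (a * F + b * Q) = n >].
have S0 : exists n, S n.
  exists (size Q); apply/asboolP; exists 0, 1; rewrite (proj2 _ F Q).
  by split; [exact: mQ | reflexivity].
case: (ex_minnP S0) => _ /asboolP[a [b [mG <-]]] Gmin.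
set G := a * F + b * Q in mG Gmin.
have Gdvd x y : right_dvd G (x * F + y * Q).
  have [U eU sU] := monic_rmodpE (x * F + y * Q) mG.
  set T := Pdiv.Ring.rmodp _ _ in eU sU.
  have [T0|nT] := eqVneq T 0.
    by exists U; apply/eqP; rewrite -subr_eq0 -eU T0.
  have [c [mc sc]] := quat_poly_normalize nT.
  suff /Gmin : S (size T) by rewrite leqNgt sU.
  apply/asboolP; exists (c%:P * (x - U * a)), (c%:P * (y - U * b)).
  suff -> : c%:P * (x - U * a) * F + c%:P * (y - U * b) * Q = c%:P * T by [].
  rewrite -!mulrA -mulrDr; congr (_ * _).
  by rewrite eU !mulrBl mulrDr opprD !mulrA addrACA.
exists a, b; split; [exact: mG | |].
  by move: (Gdvd 1 0); rewrite (proj1 _ F Q); apply.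
by move: (Gdvd 0 1); rewrite (proj2 _ F Q); apply.
Qed.

(** The generator [G] of the left ideal satisfies the definition of the greatest
    common right divisor [g].  Conversely [g] right-divides [G] and has at least
    the same degree, so that [G = g]. *)
Lemma rgcd_bezout F Q : Q \is monic ->
  [/\ rgcd F Q \is monic, right_dvd (rgcd F Q) F, right_dvd (rgcd F Q) Q
    & exists a b, rgcd F Q = a * F + b * Q].
Proof.
move=> mQ; have [a [b [mG GF GQ]]] := left_ideal_generator F mQ.
set G := a * F + b * Q in mG GF GQ.
have commonG (g : {poly quat R}) :
    right_dvd g F -> right_dvd g Q -> right_dvd g G.
  move=> [X eX] [Y eY]; exists (a * X + b * Y).
  by rewrite mulrDl -!mulrA -eX -eY.
have gG : is_rgcd F Q G.
  split; [exact: mG | exact: GF | exact: GQ |] => G' mG' G'F G'Q.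
  have [Z eZ] := commonG G' G'F G'Q.
  rewrite leqNgt; apply/negP => lt; have := lt.
  rewrite eZ => /(monic_right_small mG') Z0.
  by have := monic_neq0 mG; rewrite eZ Z0 mul0r eqxx.
have : is_rgcd F Q (rgcd F Q) by apply: xgetPex; exists G; exact: gG.
move: (rgcd F Q) => g [mg gF gQ gmax].
split; [exact: mg | exact: gF | exact: gQ |].
exists a, b; rewrite -/G.
have [Z eZ] := commonG g gF gQ.
have mZ : Z \is monic by rewrite -(monicMr Z mg) -eZ; exact: mG.
suff Z1 : size Z = 1%N.
  move: mZ; rewrite eZ [Z](size1_polyC (eq_leq Z1)) monicE lead_coefC.
  by move=> /eqP->; rewrite mul1r.
have := gmax G mG GF GQ; rewrite eZ (size_monicM mZ (monic_neq0 mg)).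
have := monic_size_gt0 mZ; have := monic_size_gt0 mg.
case: (size Z) => // -[//|m]; case: (size g) => // k _ _.
by rewrite !addSn !addnS /= ltnS ltnNge leq_addl.
Qed.

Lemma monic_dvd_exp N n h : N \is monic -> irreducible_poly N -> h \is monic ->
  h %| N ^+ n -> exists2 k, (k <= n)%N & h = N ^+ k.
Proof.
move=> mN iN; elim: n h => [|n IHn] h mh.
  rewrite expr0 dvdp1 => /eqP s1; exists 0%N; rewrite ?expr0 //.
  by apply/eqP; rewrite -eqp_monic ?monic1 // -size_poly_eq1 s1.
have [|nd] := boolP (N %| h).
  move=> /dvdpP[g eg]; rewrite eg exprSr dvdp_mul2r ?monic_neq0 //.
  move=> /IHn[|k kn ->].
    by rewrite -(monicMr g mN) -eg.
  by exists k.+1; rewrite ?ltnS // exprSr.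
have co : coprimep N h by rewrite irreducible_poly_coprime.
rewrite exprSr Gauss_dvdpl 1?coprimep_sym // => /(IHn _ mh)[k kn ek].
by exists k => //; apply: leqW.
Qed.

(** Write [W = N^n] and [G] for the greatest common right divisor. By Bezout,
    [G G^*] is a combination of [W] and [nu(Q)], hence divisible by [W]. As [G]
    also divides [W], its norm is a power [N^j] with [n <= j]. From [G F = W]
    and [G G^* = N^(j-n) W] follows [G^* = N^(j-n) F], so [n < j] would make
    the real polynomial [N] a divisor of [G] and of [Q]. *)
Lemma qnorm_rgcd N n Q : N \is monic -> irreducible_poly N -> Q \is monic ->
  primitive Q -> N ^+ n %| qnorm Q ->
  qnorm (rgcd (rpoly (N ^+ n)) Q) = N ^+ n.
Proof.
move=> mN iN mQ pQ; set W := N ^+ n => WQ.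
have sN : (1 < size N)%N by case: iN.
have [mG [F eF] [X eX] [a [b eG]]] := rgcd_bezout (rpoly W) mQ.
set G := rgcd _ _ in mG eF eX eG *.
have WG : W %| qnorm G.
  apply: (@rpoly_dvd_rpoly R (quat R)); first exact: monic_exp.
  rewrite rpoly_qnorm {1}eG mulrDl; apply: rpoly_dvdD.
    by rewrite -rpoly_comm -mulrA; exists (a * conjp G).
  rewrite eG raddfD /= !conjpM conjp_rpoly mulrDr; apply: rpoly_dvdD.
    by rewrite -!mulrA; exists (b * (Q * conjp a)); rewrite !rpolyCA.
  have -> : b * Q * (conjp Q * conjp b) = b * (rpoly (qnorm Q) * conjp b).
    by rewrite rpoly_qnorm !mulrA.
  have [k ->] := dvdpP _ _ WQ.
  exists (rpoly k * (b * conjp b)).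
  by rewrite rpolyCA rmorphM !mulrA rpoly_comm.
(* [W] is central, so its right divisor [G] is also a left divisor. *)
have GF : G * F = rpoly W.
  by apply: (monic_rreg mG); rewrite /= -mulrA -eF rpoly_comm.
have [j jn ej] : exists2 j, (j <= n + n)%N & qnorm G = N ^+ j.
  apply: monic_dvd_exp => //; first exact: qnorm_monic.
  by rewrite exprD -expr2 -qnorm_rpoly -/W eF qnormM dvdp_mull.
have nj : (n <= j)%N.
  by rewrite -(dvdp_Pexp2l n j sN) -ej.
case: (ltngtP n j) nj => // [lt _|e _]; last by rewrite ej -e.
have cG : conjp G = rpoly (N ^+ (j - n)) * F.
  apply: (monic_lreg mG); rewrite /= rpolyCA GF -rpoly_qnorm ej -rmorphM.
  by rewrite -exprD subnK // ltnW.
have GN : rpoly_dvd N G.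
  rewrite -[G]conjpK cG conjpM conjp_rpoly -rpoly_comm.
  apply: (@dvdp_rpoly_dvd _ _ _ (N ^+ (j - n))); last by exists (conjp F).
  by rewrite -{1}(expr1 N) dvdp_exp2l // subn_gt0.
have N1 : N = 1 by apply: pQ => //; rewrite eX; apply: rpoly_dvd_mull.
by case: iN; rewrite N1 size_poly1.
Qed.

End RightGcd.

(** * Quadratic factors of real polynomials without real roots *)

Section RealQuadraticFactors.
Variable R : realType.

(** A complex root [a + i b] has [b != 0], and [(X - a)^2 + b^2] is its minimal
    polynomial: a real remainder of degree at most one vanishing at [a + i b]
    is zero. *)
Lemma exists_quadratic_factor (f : {poly R}) :
  (1 < size f)%N -> (forall x, ~~ root f x) -> exists N, quadratic_factor N f.
Proof.
move=> sf nroot.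
pose toC := map_poly (real_complex R).
have [[a b] rz] : exists z : R[i], root (toC f) z.
  by apply/closed_rootP; rewrite size_map_poly; case: size sf => [|[]].
have nb : b != 0.
  apply: contraNneq (nroot a) => b0; move: rz; rewrite b0.
  by rewrite (_ : a +i* 0 = a%:C)%C // /toC fmorph_root.
pose N := ('X - a%:P) ^+ 2 + (b ^+ 2)%:P.
have sX : size (('X - a%:P) ^+ 2) = 3%N by rewrite size_exp_XsubC.
have sb : (size (b ^+ 2)%:P < size (('X - a%:P) ^+ 2)%R)%N.
  by rewrite sX size_polyC; case: (_ != 0).
have sN : size N = 3%N by rewrite size_polyDl.
have Nx x : N.[x] != 0.
  rewrite !hornerE lt0r_neq0 // ltr_wpDl ?sqr_ge0 //.
  by rewrite lt_def sqr_ge0 sqrf_eq0 nb.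
exists N; split=> //.
- by rewrite monicE lead_coefDl // -monicE monic_exp // monicXsubC.
- by apply: cubic_irreducible; rewrite ?sN.
have Nz : root (toC N) (a +i* b)%C.
  rewrite /toC rmorphD rmorphXn rmorphB /= map_polyX !map_polyC /=.
  rewrite /root !hornerE; apply/eqP.
  by congr Complex => /=; ring.
have rr : root (toC (f %% N)) (a +i* b)%C.
  move: rz; rewrite {1}(divp_eq f N) /toC rmorphD rmorphM /= /root.
  by rewrite hornerD hornerM (eqP Nz) mulr0 add0r.
rewrite /dvdp; move: (f %% N) rr (ltn_modp f N) => r.
rewrite sN -size_poly_eq0 sN /= ltnS => rr sr.
move: rr; rewrite /root (@horner_coef_wide _ 2) ?size_map_poly //.
rewrite !big_ord_recl big_ord0 !coef_map /= => /eqP[].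
rewrite !(mul0r, mulr0, mulr1, addr0, add0r, subr0) => r0 /eqP.
rewrite mulf_eq0 (negPf nb) orbF => /eqP r1.
rewrite -size_poly_leq0; apply/leq_sizeP => -[|[|i]] _.
- by move: r0; rewrite r1 mul0r addr0.
- exact: r1.
exact: (leq_sizeP _ _ sr).
Qed.

End RealQuadraticFactors.

(** * Dual quaternionic polynomials through primal and dual parts *)

Section DualPolynomials.
Variable R : realType.
Implicit Types (f g : {poly R}) (F G P D : {poly quat R}) (M : {poly dquat R}).

Lemma coef_dpoly F G i : (dpoly F G)`_i = DQuat F`_i G`_i.
Proof.
by rewrite coefD !coef_map_id0 //; congr DQuat => /=; rewrite ?addr0 ?add0r.
Qed.

Lemma coef_primal M i : (primal_part M)`_i = primal M`_i.
Proof. by rewrite coef_map_id0. Qed.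

Lemma coef_dual M i : (dual_part M)`_i = dual M`_i.
Proof. by rewrite coef_map_id0. Qed.

Lemma dpoly_eta M : M = dpoly (primal_part M) (dual_part M).
Proof.
apply/polyP => i; rewrite coef_dpoly coef_primal coef_dual.
by case: (M`_i).
Qed.

Lemma primal_dpoly F G : primal_part (dpoly F G) = F.
Proof. by apply/polyP => i; rewrite coef_primal coef_dpoly. Qed.

Lemma dual_dpoly F G : dual_part (dpoly F G) = G.
Proof. by apply/polyP => i; rewrite coef_dual coef_dpoly. Qed.

Lemma dpoly_inj F G F' G' : dpoly F G = dpoly F' G' -> F = F' /\ G = G'.
Proof.
move=> e; split; first by rewrite -(primal_dpoly F G) e primal_dpoly.
by rewrite -(dual_dpoly F G) e dual_dpoly.
Qed.

Lemma dpolyM F G F' G' :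
  dpoly F G * dpoly F' G' = dpoly (F * F') (F * G' + G * F').
Proof.
have sumE n (u : 'I_n -> dquat R) : \sum_(i < n) u i =
    DQuat (\sum_(i < n) primal (u i)) (\sum_(i < n) dual (u i)).
  elim: n u => [|n IHn] u; first by rewrite !big_ord0.
  by rewrite !big_ord_recl IHn.
apply/polyP => k; rewrite coef_dpoly coefD !coefM sumE -big_split.
by congr DQuat; apply: eq_bigr => i _; rewrite !coef_dpoly.
Qed.

Lemma rpoly_dpoly f : rpoly f = dpoly (rpoly f) 0.
Proof.
apply/polyP => i; rewrite coef_dpoly !coef_rpoly coef0.
by congr DQuat; rewrite /= scaler0.
Qed.

Lemma conj_dpoly F G :
  map_poly (@conjdq R) (dpoly F G) = dpoly (conjp F) (conjp G).
Proof.
apply/polyP => i; rewrite coef_dpoly !coef_conjp coef_map_id0 ?coef_dpoly //.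
by congr DQuat; exact: raddf0.
Qed.

Lemma nu_dpoly P D :
  nu (dpoly P D) = dpoly (rpoly (qnorm P)) (P * conjp D + D * conjp P).
Proof. by rewrite /nu conj_dpoly dpolyM rpoly_qnorm. Qed.

Lemma rnu_dpoly P D : rnu (dpoly P D) = qnorm P.
Proof.
apply/polyP => i; rewrite /rnu nu_dpoly coef_map_id0 // coef_dpoly coef_rpoly.
by rewrite /= mulr1.
Qed.

Lemma nu_motion M : motion M -> nu M = rpoly (rnu M).
Proof.
rewrite [M]dpoly_eta => -[f _]; rewrite rnu_dpoly nu_dpoly rpoly_dpoly.
by case/dpoly_inj=> _ ->; rewrite -rpoly_dpoly.
Qed.

Lemma motion_dpoly P D : P \is monic ->
  motion (dpoly P D) <-> P * conjp D + D * conjp P = 0.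
Proof.
move=> mP; split=> [[f _]|e].
  by rewrite nu_dpoly rpoly_dpoly => /dpoly_inj[].
exists (qnorm P); first by rewrite monic_neq0 ?qnorm_monic.
by rewrite nu_dpoly e -rpoly_dpoly.
Qed.

(** Monic in [{poly dquat R}] means that the leading coefficient is [1 +
    epsilon 0], so the dual part has smaller degree than the primal part. *)
Lemma monic_dpoly P D : P \is monic -> (size D < size P)%N ->
  dpoly P D \is monic /\ size (dpoly P D) = size P.
Proof.
move=> mP sD.
have sP : (0 < size P)%N by rewrite size_poly_gt0 monic_neq0.
have cP : (dpoly P D)`_(size P).-1 = 1.
  rewrite coef_dpoly [D`_ _]nth_default; last by rewrite -ltnS prednK.
  by move: mP; rewrite monicE lead_coefE => /eqP->.
have s : size (dpoly P D) = size P.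
  apply/anti_leq/andP; split.
    apply/leq_sizeP => i li; rewrite coef_dpoly !nth_default //.
    exact: leq_trans (ltnW sD) li.
  rewrite leqNgt; apply/negP => lt.
  have : (dpoly P D)`_(size P).-1 = 0.
    by rewrite nth_default // -ltnS prednK.
  by move/eqP; rewrite cP oner_eq0.
by rewrite monicE lead_coefE s cP.
Qed.

Lemma monic_parts M : M \is monic ->
  [/\ primal_part M \is monic, size (primal_part M) = size M
    & (size (dual_part M) < size M)%N].
Proof.
move=> mM; have sM : (0 < size M)%N by rewrite size_poly_gt0 monic_neq0.
have cM : M`_(size M).-1 = 1 by move: mM; rewrite monicE lead_coefE => /eqP.
have s : size (primal_part M) = size M.
  apply/anti_leq/andP; split.
    by apply/leq_sizeP => i li; rewrite coef_primal nth_default.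
  rewrite leqNgt; apply/negP => lt.
  have : (primal_part M)`_(size M).-1 = 0.
    by rewrite nth_default // -ltnS prednK.
  by move/eqP; rewrite coef_primal cM oner_eq0.
split=> //; first by rewrite monicE lead_coefE s coef_primal cM.
rewrite -(prednK sM) ltnS; apply/leq_sizeP => i.
rewrite leq_eqVlt coef_dual => /predU1P[<-|li]; first by rewrite cM.
by rewrite nth_default // -(prednK sM).
Qed.

End DualPolynomials.

(** * The splitting of a motion polynomial along coprime real factors *)

Section Splitting.
Variable R : realType.
Implicit Types (b c d f g h w N : {poly R}) (P Q D E S U X : {poly quat R}).

(** The hypothesis on [b S] is met when [b S] is [Q X] or [X Q]; the conclusion
    is what makes [c Q + epsilon S] monic. *)
Lemma exact_quotient_size b c Q X S : b \is monic -> c \is monic ->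
  Q \is monic -> (size (rpoly b * S)%R <= (size Q + size X).-1)%N ->
  (size X < size (c * b)%R)%N -> (size S < size (rpoly c * Q)%R)%N.
Proof.
move=> mb mc mQ.
have sb : (0 < size b)%N by exact: monic_size_gt0.
have sc : (0 < size c)%N by exact: monic_size_gt0.
have sQ : (0 < size Q)%N by exact: monic_size_gt0.
have -> : size (rpoly c * Q) = (size c + size Q).-1.
  by rewrite size_monicM ?rpoly_monic ?monic_neq0 // size_rpoly.
have -> : size (c * b) = (size c + size b).-1.
  by rewrite size_monicM ?monic_neq0.
have [->|nS] := eqVneq S 0; first by rewrite size_poly0; lia.
have -> : size (rpoly b * S) = (size b + size S).-1.
  by rewrite size_monicM ?rpoly_monic // size_rpoly.
have sS : (0 < size S)%N by rewrite size_poly_gt0.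
lia.
Qed.

(** Partial fractions only recover a numerator of degree below that of the
    product of the denominators; here this holds because [deg D < deg P]. *)
Lemma translation_size c1 c2 Q1 Q2 D : c1 \is monic -> c2 \is monic ->
  Q1 \is monic -> Q2 \is monic ->
  (size D < size (rpoly (c1 * c2) * (Q1 * Q2))%R)%N ->
  (size (conjp Q1 * D * conjp Q2)%R
    < size (c1 * qnorm Q1 * (c2 * qnorm Q2))%R)%N.
Proof.
move=> mc1 mc2 m1 m2.
have s1 : (0 < size Q1)%N by exact: monic_size_gt0.
have s2 : (0 < size Q2)%N by exact: monic_size_gt0.
have sc1 : (0 < size c1)%N by exact: monic_size_gt0.
have sc2 : (0 < size c2)%N by exact: monic_size_gt0.
have [n1 n2] := (qnorm_monic m1, qnorm_monic m2).
have sM (p q : {poly R}) : p \is monic -> q \is monic ->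
    size (p * q) = (size p + size q).-1.
  by move=> mp mq; rewrite size_monicM ?monic_neq0.
have -> : size (rpoly (c1 * c2) * (Q1 * Q2))
    = ((size c1 + size c2).-1 + (size Q1 + size Q2).-1).-1.
  rewrite size_monicM ?rpoly_monic ?monic_neq0 ?monicMl //.
  by rewrite size_rpoly sM // size_monicM ?monic_neq0.
rewrite !sM ?monicMl // !size_qnorm //.
have h1 : (size (conjp Q1 * D)%R <= (size Q1 + size D).-1)%N.
  by rewrite -(size_conjp Q1) size_polyMleq.
move=> sD; apply: leq_ltn_trans (size_polyMleq _ _) _.
rewrite size_conjp; lia.
Qed.

Lemma mrpf_content P Q : P \is monic -> P = rpoly (mrpf P P) * Q ->
  [/\ mrpf P P \is monic, Q \is monic & primitive Q].
Proof.
move=> mP eP; have [mc _ _ cmax] := mrpfP P (monic_neq0 mP).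
set c := mrpf P P in eP mc cmax *.
have mrc : (rpoly c : {poly quat R}) \is monic.
  by rewrite rpoly_monic; exact: mc.
split; [exact: mc | by rewrite -(monicMl Q mrc) -eP; exact: mP |].
move=> g mg gQ; have cgP : rpoly_dvd (c * g) P by rewrite eP; exact: rpoly_dvdM.
have mcg : c * g \is monic by rewrite (monicMl g mc); exact: mg.
have : c * g %| c * 1 by rewrite mulr1; exact: (cmax _ mcg cgP cgP).
rewrite dvdp_mul2l ?(monic_neq0 mc) // dvdp1 size_poly_eq1 => g1.
by apply/eqP; rewrite -eqp_monic ?monic1.
Qed.

Lemma lquo_mul Q1 Q2 : Q2 \is monic -> lquo (Q1 * Q2) Q2 = Q1.
Proof.
move=> m2; rewrite /lquo; set S := (fun _ => _).
have [Rl e sR] : S (xget 0 S).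
  apply: xgetPex; exists Q1; exists 0; rewrite ?addr0 // size_poly0.
  by rewrite size_poly_gt0 monic_neq0.
move: (xget 0 S) e => Ql e; apply/esym/eqP; rewrite -subr_eq0; apply/eqP.
by apply: (monic_right_small m2); rewrite mulrBl e addrAC subrr add0r.
Qed.

(** This isolates the [N]-primary part of [nu(P)]: [c2] is the [N]-part of the
    content, [Q2] carries what remains of [N^n], and nothing divisible by [N] is
    left in [c1 nu(Q1)]. *)
Lemma primary_split N n P Q c1 c2 w (Q2 := rgcd (rpoly w) Q) (Q1 := lquo Q Q2) :
  N \is monic -> irreducible_poly N -> N %| qnorm P -> P \is monic ->
  N ^+ n %| qnorm P -> ~~ (N ^+ n.+1 %| qnorm P) ->
  P = rpoly (mrpf P P) * Q -> c2 = mrpf P (rpoly (N ^+ n)) ->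
  mrpf P P = c1 * c2 -> N ^+ n = w * c2 ^+ 2 ->
  [/\ [/\ c1 \is monic, c2 \is monic, Q1 \is monic & Q2 \is monic],
      Q = Q1 * Q2, qnorm Q2 = w & coprimep N (c1 * qnorm Q1)].
Proof.
move=> mN iN NP mP dP ndP eP ec2 ec ew.
have sN : (1 < size N)%N by case: iN.
have n0 : (0 < n)%N by case: n ndP {dP ec2 ew} => [|//]; rewrite expr1 NP.
have [mc mQ pQ] := mrpf_content mP eP.
have [mc2 c2P c2N c2max] := mrpfP (rpoly (N ^+ n)) (monic_neq0 mP).
rewrite -ec2 in mc2 c2P c2N c2max.
have mc1 : c1 \is monic by rewrite -(monicMr c1 mc2) -ec.
have mw : w \is monic.
  by rewrite -(monicMr w (monic_exp 2 mc2)) -ew monic_exp.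
have [k _ ek] := monic_dvd_exp mN iN mc2 (rpoly_dvd_rpoly mc2 c2N).
(* [c2^2] divides [N^n], so [2 k <= n], and [n] is positive. *)
have kn : (k < n)%N.
  have : c2 ^+ 2 %| N ^+ n by rewrite ew dvdp_mull.
  rewrite ek -exprM (dvdp_Pexp2l _ _ sN); case: (k) => [//|k'].
  by apply: leq_trans; rewrite muln2 -addnn addSn ltnS addnS ltnS leq_addr.
(* Otherwise [N c2] would divide both [P] and [N^n], beyond their gcd [c2]. *)
have coc1 : coprimep N c1.
  rewrite irreducible_poly_coprime //; apply/negP => Nc1.
  suff : N ^+ k.+1 %| c2 by rewrite ek dvdp_Pexp2l // ltnn.
  apply: c2max; first exact: monic_exp.
    rewrite eP; apply: rpoly_dvd_mulr.
    apply: (@dvdp_rpoly_dvd _ _ _ (mrpf P P)).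
      by rewrite ec exprS -ek dvdp_mul.
    by exists 1; rewrite mulr1.
  apply: (@dvdp_rpoly_dvd _ _ _ (N ^+ n)); first by rewrite dvdp_exp2l.
  by exists 1; rewrite mulr1.
have eqP' : qnorm P = c1 ^+ 2 * qnorm Q * c2 ^+ 2.
  by rewrite eP qnormM qnorm_rpoly ec exprMn; ring.
have [m _ em] : exists2 m, (m <= n)%N & w = N ^+ m.
  by apply: monic_dvd_exp => //; rewrite ew dvdp_mulr.
have wQ : w %| qnorm Q.
  rewrite -(@Gauss_dvdpr _ _ (c1 ^+ 2)); last first.
    by rewrite em coprimep_expl // coprimep_expr.
  by rewrite -(@dvdp_mul2r _ (c2 ^+ 2)) ?expf_neq0 ?monic_neq0 // -ew -eqP'.
have n2 : qnorm Q2 = w by rewrite /Q2 em qnorm_rgcd // -em.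
have [m2 _ [X eX] _] := rgcd_bezout (rpoly w) mQ.
rewrite -/Q2 in m2 eX.
have e1 : Q1 = X by rewrite /Q1 eX lquo_mul.
have m1 : Q1 \is monic by rewrite e1 -(monicMr X m2) -eX; exact: mQ.
split; [| by rewrite e1 | exact: n2 |].
  by split; [exact: mc1 | exact: mc2 | exact: m1 | exact: m2].
rewrite irreducible_poly_coprime //; apply: contra ndP => N1.
rewrite eqP' eX qnormM n2 -e1.
rewrite (_ : _ * _ * _ = c1 * (c1 * qnorm Q1) * (w * c2 ^+ 2)); last by ring.
by rewrite -ew exprS dvdp_mul2r ?expf_neq0 ?monic_neq0 // dvdp_mull.
Qed.

(** The square of the content divides the norm, so the power of [N] in the
    content is at most half of the one in the norm. *)
Lemma primary_content_sqr N n P (c2 := mrpf P (rpoly (N ^+ n))) :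
  N \is monic -> irreducible_poly N -> P \is monic ->
  ~~ (N ^+ n.+1 %| qnorm P) ->
  (exists c1, mrpf P P = c1 * c2) /\ exists w, N ^+ n = w * c2 ^+ 2.
Proof.
move=> mN iN mP ndP.
have [_ [Q eP] _ cmax] := mrpfP P (monic_neq0 mP).
have [mc2 c2P c2N _] := mrpfP (rpoly (N ^+ n)) (monic_neq0 mP).
rewrite -/c2 in mc2 c2P c2N.
have [c1 ec] := dvdpP _ _ (cmax _ mc2 c2P c2P).
split; first by exists c1.
have [k _ ek] := monic_dvd_exp mN iN mc2 (rpoly_dvd_rpoly mc2 c2N).
apply/dvdpP; rewrite ek -exprM dvdp_exp2l // leqNgt; apply: contra ndP => lt.
apply: (@dvdp_trans _ (c2 ^+ 2)); first by rewrite ek -exprM dvdp_exp2l.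
by rewrite eP qnormM qnorm_rpoly ec exprMn -mulrA mulrCA dvdp_mulr.
Qed.

(** Conjugation commutes with taking remainders by a real polynomial. *)
Lemma skew_remainder d f E U D : f \is monic -> conjp E = - E ->
  D = rpoly d * E - U * rpoly f -> (size D < size f)%N -> conjp D = - D.
Proof.
move=> mf sE eD sD; apply/eqP; rewrite -addr_eq0; apply/eqP.
have e : conjp D + D = - (conjp U + U) * rpoly f.
  rewrite eD raddfB /= !conjpM !conjp_rpoly sE mulNr -(rpoly_comm d).
  by rewrite (rpoly_comm f) addrACA addNr add0r -opprD -mulrDl mulNr.
rewrite e (_ : - _ = 0) ?mul0r //.
apply: (@monic_right_small _ (rpoly f)); first by rewrite rpoly_monic.
rewrite -e size_rpoly; apply: leq_ltn_trans (size_polyD _ _) _.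
by rewrite size_conjp maxnn.
Qed.

(** With [f1 d1 + f2 d2 = 1], the remainders [D1] of [d2 E] and [D2] of [d1 E]
    satisfy [f1 D2 + D1 f2 = E] modulo [f1 f2], and both sides have degree below
    that of [f1 f2]. *)
Lemma TransFactor_spec f1 f2 E : f1 \is monic -> f2 \is monic ->
  coprimep f1 f2 -> (size E < size (f1 * f2)%R)%N ->
  exists d1 d2 U1 U2 D1 D2,
  [/\ TransFactor f1 f2 E = (dpoly (rpoly f1) D1, dpoly (rpoly f2) D2),
      D1 = rpoly d2 * E - U1 * rpoly f1 /\ D2 = rpoly d1 * E - U2 * rpoly f2,
      (size D1 < size f1)%N, (size D2 < size f2)%N &
      rpoly f1 * D2 + D1 * rpoly f2 = E].
Proof.
move=> m1 m2 co sE; rewrite /TransFactor; set c := _ + _.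
set d1 := _ *: (egcdp f1 f2).1; set d2 := _ *: (egcdp f1 f2).2.
have e1 : d1 * f1 + d2 * f2 = 1.
  have sc : size c = 1%N.
    by rewrite -(eqp_size (egcdpE f1 f2)) coprimep_size_gcd.
  have ec := size1_polyC (eq_leq sc).
  have nc : c`_0 != 0 by rewrite -polyC_eq0 -ec -size_poly_eq0 sc.
  rewrite /d1 /d2 -!scalerAl -scalerDr -/c {2}ec -mul_polyC -polyCM mulVf //.
have mr1 : (rpoly f1 : {poly quat R}) \is monic by rewrite rpoly_monic.
have mr2 : (rpoly f2 : {poly quat R}) \is monic by rewrite rpoly_monic.
have [U1 eD1 sD1] := monic_rmodpE (rpoly d2 * E) mr1.
have [U2 eD2 sD2] := monic_rmodpE (rpoly d1 * E) mr2.
set D1 := Pdiv.Ring.rmodp _ (rpoly f1) in eD1 sD1 *.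
set D2 := Pdiv.Ring.rmodp _ (rpoly f2) in eD2 sD2 *.
rewrite size_rpoly in sD1; rewrite size_rpoly in sD2.
exists d1, d2, U1, U2, D1, D2; split=> //.
have e : rpoly f1 * D2 + D1 * rpoly f2 - E = - (U1 + U2) * rpoly (f1 * f2).
  rewrite eD1 eD2 mulrBr mulrBl (rpoly_comm f1 (U2 * _)).
  rewrite -(rpoly_comm f2 (_ * E)) -!mulrA -!rmorphM (mulrC f2 f1).
  rewrite !mulrA -!rmorphM.
  rewrite addrACA -opprD -!mulrDl -rmorphD [f1 * d1]mulrC [f2 * d2]mulrC e1.
  by rewrite rmorph1 mul1r addrAC subrr add0r addrC mulNr.
apply/eqP; rewrite -subr_eq0 e; apply/eqP.
rewrite (_ : - _ = 0) ?mul0r //.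
apply: (@monic_right_small _ (rpoly (f1 * f2))).
  by rewrite rpoly_monic monicMl.
rewrite -e size_rpoly.
have s12 : size (f1 * f2) = (size f1 + size f2).-1.
  by rewrite size_monicM ?monic_neq0.
have h1 : (size (rpoly f1 * D2)%R <= (size f1 + size D2).-1)%N.
  by apply: leq_trans (size_polyMleq _ _) _; rewrite size_rpoly.
have h2 : (size (D1 * rpoly f2)%R <= (size D1 + size f2).-1)%N.
  by apply: leq_trans (size_polyMleq _ _) _; rewrite size_rpoly.
rewrite s12 in sE *; apply: leq_ltn_trans (size_polyD _ _) _.
rewrite size_polyN gtn_max sE andbT; apply: leq_ltn_trans (size_polyD _ _) _.
rewrite gtn_max (leq_ltn_trans h1) ?(leq_ltn_trans h2) //; lia.
Qed.

(** After multiplication by the real polynomials [nu(Q1)] and [nu(Q2)], the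
    left side becomes [Q1 (f1 D2 + D1 f2) Q2] and the right side [Q1 Q1^* D
    Q2^* Q2]. *)
Lemma recombine c1 c2 Q1 Q2 D D1 D2 S1 S2 : Q1 \is monic -> Q2 \is monic ->
  rpoly (c1 * qnorm Q1) * D2 + D1 * rpoly (c2 * qnorm Q2)
    = conjp Q1 * D * conjp Q2 ->
  Q1 * D1 = rpoly (qnorm Q1) * S1 -> D2 * Q2 = rpoly (qnorm Q2) * S2 ->
  rpoly c1 * Q1 * S2 + S1 * (rpoly c2 * Q2) = D.
Proof.
move=> m1 m2 eE e1 e2.
have mr1 := rpoly_qnorm_monic m1.
have mr2 := rpoly_qnorm_monic m2.
apply: (monic_lreg mr1); apply: (monic_rreg mr2) => /=.
have -> : rpoly (qnorm Q1) * D * rpoly (qnorm Q2)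
    = Q1 * (conjp Q1 * D * conjp Q2) * Q2.
  by rewrite rpoly_qnorm (rpoly_qnorm_conjp Q2) !mulrA.
rewrite -eE [in LHS]mulrDr [in RHS]mulrDr !mulrDl; congr (_ + _).
  rewrite rpolyCA -!mulrA e2 rmorphM -!mulrA.
  rewrite -[S2 * _]rpoly_comm [rpoly (qnorm Q1) * (rpoly c1 * _)]rpolyCA.
  by congr (_ * (_ * _)).
rewrite !mulrA -e1 rmorphM -!mulrA; congr (_ * (_ * (_ * _))).
by rewrite rpoly_comm.
Qed.

(** Conjugating [Q1 D1 = nu(Q1) S1] shows that the expression, multiplied by
    [nu(Q1)], is [c Q1 (D1^* + D1) Q1^*]. *)
Lemma left_factor_motion c Q1 D1 S1 : Q1 \is monic -> conjp D1 = - D1 ->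
  Q1 * D1 = rpoly (qnorm Q1) * S1 ->
  rpoly c * Q1 * conjp S1 + S1 * conjp (rpoly c * Q1) = 0.
Proof.
move=> m1 skew e.
have mr1 := rpoly_qnorm_monic m1.
rewrite conjpM conjp_rpoly -rpoly_comm rpolyCA -mulrA -mulrDr.
have cS : rpoly (qnorm Q1) * conjp S1 = - (D1 * conjp Q1).
  by rewrite rpoly_comm -(conjp_rpoly (qnorm Q1)) -conjpM -e conjpM skew mulNr.
rewrite (_ : _ + _ = 0) ?mulr0 //; apply: (monic_lreg mr1).
by rewrite /= mulr0 mulrDr -rpolyCA cS mulrA -e mulrN mulrA addNr.
Qed.

Lemma right_factor_motion c Q2 D2 S2 : Q2 \is monic -> conjp D2 = - D2 ->
  D2 * Q2 = rpoly (qnorm Q2) * S2 ->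
  rpoly c * Q2 * conjp S2 + S2 * conjp (rpoly c * Q2) = 0.
Proof.
move=> m2 skew e.
have mr2 := rpoly_qnorm_monic m2.
rewrite conjpM conjp_rpoly -rpoly_comm rpolyCA -mulrA -mulrDr.
have cS : rpoly (qnorm Q2) * conjp S2 = - (conjp Q2 * D2).
  by rewrite rpoly_comm -(conjp_rpoly (qnorm Q2)) -conjpM -e conjpM skew mulrN.
rewrite (_ : _ + _ = 0) ?mulr0 //; apply: (monic_lreg mr2).
rewrite /= mulr0 mulrDr -rpolyCA cS mulrA -e mulrN !mulrA -rpoly_qnorm.
by rewrite -mulrA -rpoly_qnorm rpoly_comm addNr.
Qed.

(** Up to the real factor [c nu(Q1)], the sum [E^* + E] is obtained from [P D^*
    + D P^*] by multiplying with [Q1^*] on the left and [Q1] on the right. *)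
Lemma translation_skew c Q1 Q2 D (P := rpoly c * (Q1 * Q2))
  (E := conjp Q1 * D * conjp Q2) : c \is monic -> Q1 \is monic ->
  P * conjp D + D * conjp P = 0 -> conjp E = - E.
Proof.
move=> mc m1 study.
have mr : (rpoly (c * qnorm Q1) : {poly quat R}) \is monic.
  by rewrite rpoly_monic monicMl // qnorm_monic.
apply/eqP; rewrite -addr_eq0; apply/eqP; apply: (monic_lreg mr) => /=.
transitivity (conjp Q1 * (P * conjp D + D * conjp P) * Q1); last first.
  by rewrite study !mulr0 mul0r.
rewrite mulrDr mulrDr mulrDl; congr (_ + _).
  rewrite /P /E !conjpM !conjpK rpolyM rpoly_qnorm_conjp.
  by rewrite -!mulrA rpolyCA.
rewrite /P /E !conjpM conjp_rpoly rpolyM -(rpoly_comm c) -!mulrA.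
rewrite -rpoly_qnorm_conjp -(rpoly_comm (qnorm Q1)).
rewrite (rpolyCA c D) (rpolyCA c (conjp Q1)).
by rewrite (rpolyCA (qnorm Q1) D) (rpolyCA (qnorm Q1) (conjp Q1)).
Qed.

(** For [X = D Q2^*] the second factor of the left side is the remainder of [d
    E] by [f1], with [E = Q1^* D Q2^*] and [f1 = c nu(Q1)]. *)
Lemma left_exact_quotient c d Q1 X U : exists S,
  Q1 * (rpoly d * (conjp Q1 * X) - U * rpoly (c * qnorm Q1))
    = rpoly (qnorm Q1) * S.
Proof.
exists (rpoly d * X - rpoly c * (Q1 * U)).
rewrite -(rpoly_comm _ U) !mulrBr (rpolyCA d) (rpolyCA (c * _)).
congr (_ - _); first by rewrite [RHS]rpolyCA rpoly_qnorm -mulrA.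
by rewrite [RHS]mulrA -rpolyM (mulrC (qnorm _)).
Qed.

Lemma right_exact_quotient c d Q2 X U : exists S,
  (rpoly d * (X * conjp Q2) - U * rpoly (c * qnorm Q2)) * Q2
    = rpoly (qnorm Q2) * S.
Proof.
exists (rpoly d * X - rpoly c * (U * Q2)).
rewrite -(rpoly_comm _ U) mulrBr mulrBl; congr (_ - _).
  by rewrite [RHS]rpolyCA (rpoly_comm (qnorm Q2)) rpoly_qnorm_conjp -!mulrA.
by rewrite [RHS]mulrA -rpolyM (mulrC (qnorm _)) mulrA.
Qed.

End Splitting.

(** * The factorization algorithm *)

Section Algorithm.
Variable R : realType.
Implicit Types (c f w N : {poly R}) (P Q D E : {poly quat R}).
Implicit Types (M : {poly dquat R}).

Lemma reduced_left_divisor M M' X :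
  M != 0 -> reduced M -> M = M' * X -> reduced M'.
Proof.
move=> nM rM eM.
have nM' : M' != 0 by apply: contraNneq nM => z; rewrite eM z mul0r.
have [_ _ _ mx] := mrpfP M nM; rewrite rM in mx.
have [mg gM' _ _] := mrpfP M' nM'.
have gM : rpoly_dvd (mrpf M' M') M by rewrite eM; exact: rpoly_dvd_mulr.
have := mx _ mg gM gM; rewrite dvdp1 size_poly_eq1 => g1.
by apply/eqP; rewrite -eqp_monic ?monic1.
Qed.

Lemma bounded_norm_root M x : bounded M -> ~~ root (rnu M) x.
Proof.
case=> mM _ _ noroot.
have [mP _ _] := monic_parts mM.
have [mc [Q eP] _ _] := mrpfP (primal_part M) (monic_neq0 mP).
have [_ _ pQ] := mrpf_content mP eP.
rewrite [M]dpoly_eta rnu_dpoly eP qnormM qnorm_rpoly.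
rewrite rootM negb_or primitive_norm_root // andbT.
by rewrite /root horner_exp expf_eq0 /=; exact: noroot.
Qed.

Lemma bounded_parts M : bounded M ->
  [/\ primal_part M \is monic, (size (dual_part M) < size (primal_part M))%N
    & primal_part M * conjp (dual_part M)
        + dual_part M * conjp (primal_part M) = 0].
Proof.
case=> mM mo _ _; have [mP sP sD] := monic_parts mM; rewrite sP; split=> //.
by apply/motion_dpoly; rewrite -?dpoly_eta.
Qed.

Lemma rpoly_monicM c Q :
  c \is monic -> Q \is monic -> rpoly c * Q \is monic.
Proof.
by move=> mc mQ; rewrite monicMl; [exact: mQ | rewrite rpoly_monic; exact: mc].
Qed.

(** The outputs [D1], [D2] of [TransFactor] are skew, of degree below [f1],
    [f2], and satisfy [f1 D2 + D1 f2 = E]; these three facts yield that both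
    factors are motion polynomials, that they are monic, and that their product
    is [M]. *)
Lemma MGFactor_step_sound M N M' Ml : bounded M -> quadratic_factor N (rnu M) ->
  MGFactor_step M N M' Ml ->
  [/\ bounded M', Ml \is monic /\ motion Ml, M = M' * Ml,
      exists2 n, (0 < n)%N & nu Ml = rpoly (N ^+ n)
    & [/\ coprimep (rnu M') N, rnu M' %| rnu M & (size M' < size M)%N]].
Proof.
move=> bM qN step.
case: step bM qN => n c1 c2 w f1 f2 P D Q Q1 Q2 E D1 D2 S1 S2.
move=> eP eD dP ndP ePQ ec2 ec ew eQ2 eQ1 ef1 ef2 eE mf1 mf2 co _ eT.
move=> _ eS1 eS2 bM [mN _ iN NP].
have [mP sD study] := bounded_parts bM.
have eM := dpoly_eta M; rewrite -eP -eD in eM mP sD study.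
have rP : rnu M = qnorm P by rewrite eM rnu_dpoly.
rewrite rP in dP ndP NP.
have [[mc1 mc2 m1 m2] eQ q2 coN] :
  [/\ [/\ c1 \is monic, c2 \is monic, Q1 \is monic & Q2 \is monic],
      Q = Q1 * Q2, qnorm Q2 = w & coprimep N (c1 * qnorm Q1)].
  by rewrite eQ1 eQ2; exact: primary_split mN iN NP mP dP ndP ePQ ec2 ec ew.
have mc : c1 * c2 \is monic by rewrite (monicMl _ mc1).
have ePf : P = rpoly (c1 * c2) * (Q1 * Q2) by rewrite ePQ ec eQ.
have skE : conjp E = - E.
  by rewrite eE; apply: (translation_skew mc m1); rewrite -ePf; exact: study.
have sE : (size E < size (f1 * f2)%R)%N.
  rewrite eE ef1 ef2; apply: (translation_size mc1 mc2 m1 m2).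
  by rewrite -ePf; exact: sD.
have [d1 [d2 [U1 [U2 [D1' [D2' [eT' [eD1 eD2] sD1 sD2 eE']]]]]]] :=
  TransFactor_spec mf1 mf2 co sE.
have [e1 e2] : D1' = D1 /\ D2' = D2.
  by move: eT'; rewrite eT => -[/dpoly_inj[_ ->] /dpoly_inj[_ ->]].
rewrite {}e1 {}e2 in eD1 eD2 sD1 sD2 eE'.
have sk1 := skew_remainder mf1 skE eD1 sD1.
have sk2 := skew_remainder mf2 skE eD2 sD2.
rewrite ef1 ef2 eE in eE'; rewrite ef1 in sD1; rewrite ef2 in sD2.
have eDS := recombine m1 m2 eE' eS1 eS2.
have mP1 := rpoly_monicM mc1 m1.
have mP2 := rpoly_monicM mc2 m2.
have sS1 : (size S1 < size (rpoly c1 * Q1)%R)%N.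
  apply: exact_quotient_size (qnorm_monic m1) mc1 m1 _ sD1.
  by rewrite -eS1 size_polyMleq.
have sS2 : (size S2 < size (rpoly c2 * Q2)%R)%N.
  apply: exact_quotient_size (qnorm_monic m2) mc2 m2 _ sD2.
  by rewrite -eS2 addnC size_polyMleq.
have eP12 : P = rpoly c1 * Q1 * (rpoly c2 * Q2).
  by rewrite ePf rpolyM -!mulrA (rpolyCA c2 Q1).
have eMM : M = dpoly (rpoly c1 * Q1) S1 * dpoly (rpoly c2 * Q2) S2.
  by rewrite dpolyM eDS -eP12.
have [mM1 sM1] := monic_dpoly mP1 sS1.
have [mM2 sM2] := monic_dpoly mP2 sS2.
have mo1 : motion (dpoly (rpoly c1 * Q1) S1).
  by apply/(motion_dpoly _ mP1); exact: left_factor_motion m1 sk1 eS1.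
have mo2 : motion (dpoly (rpoly c2 * Q2) S2).
  by apply/(motion_dpoly _ mP2); exact: right_factor_motion m2 sk2 eS2.
have n2 : qnorm (rpoly c2 * Q2) = N ^+ n.
  by rewrite qnormM qnorm_rpoly q2 ew mulrC.
have n0 : (0 < n)%N.
  by case: n {dP ec2 ew n2} ndP => // /negP; rewrite expr1 NP.
have [mM _ redM noroot] := bM.
split.
- split; [exact: mM1 | exact: mo1 | |].
    exact: (reduced_left_divisor (monic_neq0 mM) redM eMM).
  move=> x; rewrite primal_dpoly; apply: contra (noroot x).
  rewrite !root_factor_theorem => /dvdp_trans; apply.
  have [mg dvd1 _ _] := mrpfP (rpoly c1 * Q1) (monic_neq0 mP1).
  rewrite -eP; have [_ _ _ cmax] := mrpfP P (monic_neq0 mP).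
  have gP : rpoly_dvd (mrpf (rpoly c1 * Q1) (rpoly c1 * Q1)) P.
    by rewrite eP12; exact: rpoly_dvd_mulr dvd1.
  exact: (cmax _ mg gP gP).
- by split; [exact: mM2 | exact: mo2].
- exact: eMM.
- by exists n; [exact: n0 | rewrite (nu_motion mo2) rnu_dpoly n2].
split.
- rewrite rnu_dpoly qnormM qnorm_rpoly coprimep_sym.
  move: coN; rewrite !coprimepMr => /andP[coc1 ->].
  by rewrite coc1.
- by rewrite rP eP12 rnu_dpoly [X in _ %| X]qnormM dvdp_mulr.
rewrite sM1; have [_ <- _] := monic_parts mM; rewrite -eP eP12.
rewrite (size_monicM mP1 (monic_neq0 mP2)).
have sNn : (size N <= size (N ^+ n))%N.
  by rewrite dvdp_leq ?dvdp_exp // expf_neq0 ?monic_neq0.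
have [sN _] := iN; move: (leq_trans sN sNn); rewrite -n2 (size_qnorm mP2).
case: (size (rpoly c2 * Q2)) => [|[|k]] // _.
by rewrite !addnS /= ltnS leq_addr.
Qed.

Lemma exists_multiplicity N f : irreducible_poly N -> f != 0 ->
  exists2 n, N ^+ n %| f & ~~ (N ^+ n.+1 %| f).
Proof.
move=> [sN _] nf; have bnd n : N ^+ n %| f -> (n <= size f)%N.
  move=> /(dvdp_leq nf); apply: leq_trans.
  have := size_exp N n; move: (size N) (size (N ^+ n)) sN => a b.
  by nia.
have ex0 : exists n, N ^+ n %| f by exists 0%N; rewrite expr0 dvd1p.
case: (ex_maxnP ex0 bnd) => n dn nmax; exists n => //.
by apply/negP => /nmax; rewrite ltnn.
Qed.

Lemma MGFactor_step_exists M N : bounded M -> quadratic_factor N (rnu M) ->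
  exists M' Ml, MGFactor_step M N M' Ml.
Proof.
move=> bM [mN _ iN NP].
have [mP sD study] := bounded_parts bM.
have eM := dpoly_eta M.
pose P := primal_part M; pose D := dual_part M.
rewrite -/P -/D in mP sD study eM.
have rP : rnu M = qnorm P by rewrite eM rnu_dpoly.
have [n dP ndP] : exists2 n, N ^+ n %| qnorm P & ~~ (N ^+ n.+1 %| qnorm P).
  exact: exists_multiplicity iN (monic_neq0 (qnorm_monic mP)).
rewrite rP in NP.
have [[c1 ec] [w ew]] := primary_content_sqr mN iN mP ndP.
have [_ [Q ePQ] _ _] := mrpfP P (monic_neq0 mP).
have [[mc1 mc2 m1 m2] eQ q2 coN] :=
  primary_split mN iN NP mP dP ndP ePQ erefl ec ew.
have [c2 ec2] : exists c2, c2 = mrpf P (rpoly (N ^+ n)) by eexists.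
rewrite -ec2 in ec ew mc2.
have [Q2 eQ2] : exists Q2, Q2 = rgcd (rpoly w) Q by eexists.
rewrite -eQ2 in m1 m2 eQ q2 coN.
have [Q1 eQ1] : exists Q1, Q1 = lquo Q Q2 by eexists.
rewrite -eQ1 in m1 eQ coN.
pose f1 := c1 * qnorm Q1; pose f2 := c2 * qnorm Q2.
pose E := conjp Q1 * D * conjp Q2.
have mf1 : f1 \is monic by rewrite (monicMl _ mc1); exact: qnorm_monic m1.
have mf2 : f2 \is monic by rewrite (monicMl _ mc2); exact: qnorm_monic m2.
have co : coprimep f1 f2.
  rewrite coprimep_sym; apply: (@coprimep_dvdr _ (N ^+ n)).
    by rewrite /f2 q2 ew expr2 mulrA [c2 * w]mulrC dvdp_mulr.
  by rewrite coprimep_expl.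
have mc : c1 * c2 \is monic by rewrite (monicMl _ mc1).
have ePf : P = rpoly (c1 * c2) * (Q1 * Q2) by rewrite {1}ePQ ec eQ.
have skE : conjp E = - E.
  by apply: (translation_skew mc m1); rewrite -ePf; exact: study.
have sE : (size E < size (f1 * f2)%R)%N.
  by apply: (translation_size mc1 mc2 m1 m2); rewrite -ePf; exact: sD.
have [d1 [d2 [U1 [U2 [D1 [D2 [eT [eD1 eD2] sD1 sD2 eE]]]]]]] :=
  TransFactor_spec mf1 mf2 co sE.
have [S1 eS1] : exists S1, Q1 * D1 = rpoly (qnorm Q1) * S1.
  by rewrite eD1 /E -(mulrA (conjp Q1)); exact: left_exact_quotient.
have [S2 eS2] : exists S2, D2 * Q2 = rpoly (qnorm Q2) * S2.
  by rewrite eD2; exact: right_exact_quotient.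
exists (dpoly (rpoly c1 * Q1) S1), (dpoly (rpoly c2 * Q2) S2).
apply: (@MGFactorStep _ M N n c1 c2 w f1 f2 P D Q Q1 Q2 E D1 D2 S1 S2
  erefl erefl _ _ ePQ ec2 ec ew eQ2 eQ1 erefl erefl erefl mf1 mf2 co _ eT _
  eS1 eS2).
- by rewrite rP.
- by rewrite rP.
- apply/motion_dpoly; first by rewrite rpoly_monic (monicMl _ mf1).
  by rewrite conjp_rpoly skE mulrN -rpoly_comm addNr.
by rewrite dpolyM -rpolyM eE.
Qed.

(** The norm of [M] has no real root, so a quadratic factor exists as long as
    the degree is positive, and each step returns a bounded left factor of
    smaller degree. *)
Lemma MGFactor_terminates M :
  bounded M -> MGFactor_total M /\ exists L, MGFactor M L.
Proof.
have [n] := ubnP (size M); elim: n => // n IHn in M *; rewrite ltnS => sM bM.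
have [mM _ _ _] := bM; have := monic_size_gt0 mM.
rewrite leq_eqVlt => /predU1P[/esym s1|s1].
  by split; [exact: MGFactor_total_nil | exists [::]; exact: MGFactor_nil].
have [N qN] : exists N, quadratic_factor N (rnu M).
  apply: exists_quadratic_factor => [|x]; last exact: bounded_norm_root.
  have [mP sP _] := monic_parts mM.
  by rewrite [M]dpoly_eta rnu_dpoly size_qnorm // sP; move: (size M) s1; lia.
have IH K M' Ml : quadratic_factor K (rnu M) -> MGFactor_step M K M' Ml ->
    bounded M' /\ (MGFactor_total M' /\ exists L, MGFactor M' L).
  move=> qK st; have [bM' _ _ _ [_ _ sM']] := MGFactor_step_sound bM qK st.
  by split; [exact: bM' | exact: IHn (leq_trans sM' sM) bM'].
split.
  apply: (MGFactor_total_rec s1) => [|K|K M' Ml qK st].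
  - by exists N; exact: qN.
  - exact: MGFactor_step_exists.
  - by have [bM' [tM' _]] := IH _ _ _ qK st; split; [exact: bM' | exact: tM'].
have [M' [Ml st]] := MGFactor_step_exists bM qN.
have [_ [_ [L run]]] := IH _ _ _ qN st.
by exists (rcons L Ml); exact: MGFactor_rcons s1 qN st run.
Qed.

(** The induction carries the extra invariant that every [N] used divides [nu
    M]: the norm of the left factor is coprime to the quadratic chosen last,
    hence so are the quadratics found in the recursive call. *)
Lemma MGFactor_correct M L : MGFactor M L -> bounded M ->
  [/\ (forall Mi, Mi \in L -> Mi \is monic /\ motion Mi),
      M = \prod_(Mi <- L) Mi
    & exists (Ns : seq {poly R}) (ns : seq nat),
      [/\ size Ns = size L /\ size ns = size L,
          (forall N, N \in Ns -> size N = 3%N /\ irreducible_poly N)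
            /\ (forall N, N \in Ns -> N %| rnu M),
          (forall n, n \in ns -> (0 < n)%N),
          (forall i j, (i < j < size Ns)%N -> coprimep Ns`_i Ns`_j)
        & forall i, (i < size L)%N ->
            nu L`_i = rpoly (Ns`_i ^+ nth 0%N ns i)]].
Proof.
elim=> {M L} [M s1|M N M' Ml L s1 qN st _ IH] bM.
  split=> //; last by exists [::], [::]; split=> [||m|i j /andP[]|].
  have [mM _ _ _] := bM; rewrite big_nil [M](size1_polyC (eq_leq s1)).
  by move: mM; rewrite monicE lead_coefE s1 => /eqP->; rewrite polyC1.
have [bM' moMl eM [n n0 nuMl] [co dvM _]] := MGFactor_step_sound bM qN st.
have [HL eM' [Ns [ns [[sNs sns] [qNs dNs] pns coNs nuNs]]]] := IH bM'.
have [_ sN iN NM] := qN.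
split.
- by move=> Mi; rewrite mem_rcons inE => /predU1P[->|/HL].
- by rewrite -cats1 big_cat big_seq1 -eM'.
exists (rcons Ns N), (rcons ns n); split.
- by rewrite !size_rcons sNs sns.
- split=> K; rewrite mem_rcons inE => /predU1P[->|] //; first exact: qNs.
  by move=> /dNs dK; apply: dvdp_trans dK dvM.
- by move=> m; rewrite mem_rcons inE => /predU1P[->|/pns].
- move=> i j; rewrite size_rcons ltnS => /andP[ij]; rewrite leq_eqVlt.
  rewrite !nth_rcons => /predU1P[ej|jN].
    rewrite ej ltnn eqxx -ej ij.
    by apply: coprimep_dvdr co; apply: dNs; apply: mem_nth; rewrite -ej.
  by rewrite jN (ltn_trans ij jN) coNs // ij.
move=> i; rewrite size_rcons ltnS leq_eqVlt !nth_rcons sNs sns.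
case/predU1P=> [->|iL]; first by rewrite ltnn eqxx.
by rewrite iL nuNs.
Qed.

End Algorithm.

Theorem proposition3 (R : realType) (M : {poly dquat R}) (hM : bounded M) :
  [/\ MGFactor_total M, (exists L, MGFactor M L)
    & forall L : seq {poly dquat R}, MGFactor M L ->
      [/\ (forall Mi, Mi \in L -> Mi \is monic /\ motion Mi),
          M = \prod_(Mi <- L) Mi
        & exists (Ns : seq {poly R}) (ns : seq nat),
          [/\ size Ns = size L /\ size ns = size L,
              (forall N, N \in Ns -> size N = 3%N /\ irreducible_poly N),
              (forall n, n \in ns -> (0 < n)%N),
              (forall i j, (i < j < size Ns)%N -> coprimep Ns`_i Ns`_j)
            & forall i, (i < size L)%N ->
                nu L`_i = rpoly (Ns`_i ^+ nth 0%N ns i)]]].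
Proof.
have [tM run] := MGFactor_terminates hM; split; [exact: tM | exact: run |].
move=> L runL.
have [mo eM [Ns [ns [s [q _] p co n]]]] := MGFactor_correct runL hM.
by split=> //; exists Ns, ns; split.
Qed.
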